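(* Let $(\epsilon,a)\in\{\pm1\}\times(0,1]$ with $(\epsilon,a)\ne(1,1)$. The generic hyperbolic equation $$(\epsilon+a)^2(2s-t^2)^3+\epsilon a\left(3r-6st+2t^3\right)^2=0$$ has the symmetry generators $$X_1=\partial_x,\quad X_2=\partial_y,\quad X_3=\partial_z,\quad X_4=x\partial_z,\quad X_5=y\partial_z,\quad X_6=x\partial_x+y\partial_y+2z\partial_z,$$ as well as $$X_7=y\partial_y+3z\partial_z,\quad X_8=x\partial_y-\frac12y^2\partial_z,\quad X_9=x^2\partial_x+xy\partial_y+\left(xz-\frac16y^3\right)\partial_z.$$
   Context: $J^2(\mathbb{R}^2,\mathbb{R})$ has coordinates $(x,y,z,p,q,r,s,t)$ with $p=z_x,q=z_y,r=z_{xx},s=z_{xy},t=z_{yy}$; all considerations are local and smooth. A vector field $X$ on $J^0(\mathbb{R}^2,\mathbb{R})$ (coordinates $(x,y,z)$) has a unique prolongation $X^{(2)}$ to $J^2(\mathbb{R}^2,\mathbb{R})$ preserving the contact system generated by $dz-p\,dx-q\,dy$, $dp-r\,dx-s\,dy$, $dq-s\,dx-t\,dy$. $X$ is a symmetry of $F=0$ if $\mathcal{L}_{X^{(2)}}F=0$ whenever $F=0$. *)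

(* Defs.v *)
From HB Require Import structures.
From mathcomp Require Import all_boot all_order all_algebra.
From mathcomp Require Import all_classical all_reals all_analysis.
Set Implicit Arguments.
Unset Strict Implicit.
Unset Printing Implicit Defensive.
Import Order.TTheory GRing.Theory Num.Theory.
Import numFieldNormedType.Exports.
Local Open Scope ring_scope.

(* C^k and C^oo maps; in finite dimension, f is C^k.+1 iff it is
   differentiable and all its directional derivatives are C^k. *)
Fixpoint Ck (R : realType) (V W : normedModType R) (k : nat) (f : V -> W) : Prop :=
  match k with
  | 0 => continuous f
  | k'.+1 => (forall x, differentiable f x) /\
             (forall v : V, Ck k' (fun x => 'D_v f x))
  end.

Definition smooth (R : realType) (V W : normedModType R) (f : V -> W) : Prop :=
  forall k, Ck k f.

(* Jet spaces in their standard coordinates: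
   (x, y, z) on J^0(R^2, R) and (x, y, z, p, q, r, s, t) on J^2(R^2, R). *)
Notation J0 R := 'rV[R]_3.
Notation J2 R := 'rV[R]_8.

Definition x0 (R : realType) (n : J0 R) : R := n 0 (@Ordinal 3 0 isT).
Definition y0 (R : realType) (n : J0 R) : R := n 0 (@Ordinal 3 1 isT).
Definition z0 (R : realType) (n : J0 R) : R := n 0 (@Ordinal 3 2 isT).

Definition jx (R : realType) (m : J2 R) : R := m 0 (@Ordinal 8 0 isT).
Definition jy (R : realType) (m : J2 R) : R := m 0 (@Ordinal 8 1 isT).
Definition jz (R : realType) (m : J2 R) : R := m 0 (@Ordinal 8 2 isT).
Definition jp (R : realType) (m : J2 R) : R := m 0 (@Ordinal 8 3 isT).
Definition jq (R : realType) (m : J2 R) : R := m 0 (@Ordinal 8 4 isT).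
Definition jr (R : realType) (m : J2 R) : R := m 0 (@Ordinal 8 5 isT).
Definition js (R : realType) (m : J2 R) : R := m 0 (@Ordinal 8 6 isT).
Definition jt (R : realType) (m : J2 R) : R := m 0 (@Ordinal 8 7 isT).

(* The projection J^2 -> J^0; it is linear, hence also its own differential. *)
Definition jproj (R : realType) (m : J2 R) : J0 R :=
  \row_(i < 3) [:: jx m; jy m; jz m]`_i.

Definition Dx (R : realType) : J0 R := delta_mx 0 (@Ordinal 3 0 isT).
Definition Dy (R : realType) : J0 R := delta_mx 0 (@Ordinal 3 1 isT).
Definition Dz (R : realType) : J0 R := delta_mx 0 (@Ordinal 3 2 isT).
Arguments Dx {R}.
Arguments Dy {R}.
Arguments Dz {R}.

(* Vector fields on V are maps V -> V; a 1-form w is evaluated at a point m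
   and a tangent vector v as w m v. *)
Definition lie_fun (R : realType) (V : normedModType R)
  (Y : V -> V) (F : V -> R) : V -> R := fun m => 'D_(Y m) F m.

(* (L_Y w)(v) = Y (w(v)) - w([Y, v]), where [Y, v] = - D_v Y since v is
   extended to a constant vector field. *)
Definition lie_form (R : realType) (V : normedModType R)
  (Y : V -> V) (w : V -> V -> R) : V -> V -> R :=
  fun m v => 'D_(Y m) (fun m' => w m' v) m + w m ('D_v Y m).

(* The coordinates of the tangent vector v are dx(v), ..., dt(v), so the forms
   are dz - p dx - q dy, dp - r dx - s dy and dq - s dx - t dy. *)
Definition contact_form (R : realType) (i : 'I_3) (m v : J2 R) : R :=
  [:: jz v - jp m * jx v - jq m * jy v;
      jp v - jr m * jx v - js m * jy v;
      jq v - js m * jx v - jt m * jy v]`_i.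

Definition preserves_contact (R : realType) (Y : J2 R -> J2 R) : Prop :=
  exists lam : 'I_3 -> 'I_3 -> J2 R -> R,
    (forall i j, smooth (lam i j)) /\
    forall i m v, lie_form Y (contact_form i) m v =
                  \sum_j lam i j m * contact_form j m v.

Definition is_prolongation (R : realType)
  (X : J0 R -> J0 R) (Y : J2 R -> J2 R) : Prop :=
  [/\ smooth Y,
      forall m, jproj (Y m) = X (jproj m)
    & preserves_contact Y].

(* Y is the unique prolongation X^(2) of X. *)
Definition is_symmetry (R : realType) (F : J2 R -> R) (X : J0 R -> J0 R) : Prop :=
  smooth X /\
  exists Y : J2 R -> J2 R,
    [/\ is_prolongation X Y,
        forall Y', is_prolongation X Y' -> Y' = Y
      & forall m, F m = 0 -> lie_fun Y F m = 0].

(* Main.v *)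
(* If Y preserves the contact system, then L_Y of the contact form
   dm_k - m_a dx - m_b dy vanishes on the total derivatives, which lie in the
   kernel of the contact forms. This expresses the a and b components of Y
   through its x, y and k components, so (x, y, z) determine (p, q), then
   (r, s) and (s, t): prolongations are unique. They are also linear in the
   field, so it suffices to treat the general combination of X_1, ..., X_9 with
   coefficients c_1, ..., c_9; its prolongation rescales 2s - t^2 by
   2 c_7 - 2 c_9 x and 3r - 6st + 2t^3 by 3 c_7 - 3 c_9 x, hence F by
   6 c_7 - 6 c_9 x. *)
Require Import Defs.
From mathcomp Require Import all_boot all_order all_algebra.
From mathcomp Require Import all_classical all_reals all_analysis.
From mathcomp Require Import ring.
Import Order.TTheory GRing.Theory Num.Theory.
Import numFieldNormedType.Exports.
Local Open Scope ring_scope.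

(** * Directional derivatives of polynomials in the coordinates *)

Section PointwiseDerivatives.
Context {R : realType} {V : normedModType R}.
Implicit Types (f g : V -> R) (x v : V).

(** In this and the next three rules the operation stands under the binder, so that [is_derive_poly]
    can match them against explicit polynomials in the coordinates. *)
Lemma is_derive_ptD f g x v df dg : is_derive x v f df -> is_derive x v g dg ->
  is_derive x v (fun y => f y + g y) (df + dg).
Proof. by move=> hf hg; exact: is_deriveD. Qed.

Lemma is_derive_ptN f x v df : is_derive x v f df ->
  is_derive x v (fun y => - f y) (- df).
Proof. by move=> hf; exact: is_deriveN. Qed.

Lemma is_derive_ptM f g x v df dg : is_derive x v f df -> is_derive x v g dg ->
  is_derive x v (fun y => f y * g y) (f x * dg + g x * df).
Proof. by move=> hf hg; exact: is_deriveM. Qed.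

Lemma is_derive_ptX f n x v df : is_derive x v f df ->
  is_derive x v (fun y => f y ^+ n) (n%:R * f x ^+ n.-1 * df).
Proof.
move=> hf; have := is_deriveX n hf.
rewrite (_ : f ^+ n = fun y => f y ^+ n) //.
by apply/funext => y; rewrite exprfctE.
Qed.

End PointwiseDerivatives.

Lemma is_derive_coord (R : realType) (m n : nat) (x v : 'M[R]_(m, n)) i j :
  is_derive x v (fun y : 'M[R]_(m, n) => y i j) (v i j).
Proof.
have hd := differentiable_coord x i j.
apply: DeriveDef; first exact: diff_derivable.
have did : derivable (fun y : 'M[R]_(m, n) => y) x v by exact: derivable_id.
by have /matrixP/(_ i j) := derive_mx did; rewrite mxE derive_id => <-.
Qed.

Ltac is_derive_poly :=
  repeat first [ apply: is_derive_cst | apply: is_derive_coord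
               | apply: is_derive_ptD | apply: is_derive_ptN
               | apply: is_derive_ptM | apply: is_derive_ptX ].

(** * Smoothness of polynomial maps *)

Section Smooth.
Context {R : realType}.

Section Generic.
Context {V : normedModType R}.

(** The Leibniz rule leaves undifferentiated factors behind; their class has to drop by one for the
    induction in [CkM]. *)
Lemma Ck_le (W : normedModType R) (f : V -> W) (k : nat) : Ck k.+1 f -> Ck k f.
Proof.
elim: k f => [f [df _] x|k IH f [df dDf]].
  exact: differentiable_continuous.
by split=> // v; apply: IH; exact: dDf.
Qed.

Lemma Ck_cst (W : normedModType R) (a : W) (k : nat) : Ck k (fun _ : V => a).
Proof.
elim: k a => [a x|k IH a]; first exact: cvg_cst.
split=> [x|v]; first exact: differentiable_cst.
rewrite [X in Ck k X](_ : _ = fun _ => 0); first exact: IH.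
by apply/funext => x; exact: derive_cst.
Qed.

Lemma CkD (f g : V -> R) (k : nat) :
  Ck k f -> Ck k g -> Ck k (fun x => f x + g x).
Proof.
elim: k f g => [f g cf cg x|k IH f g [df Df] [dg Dg]].
  by apply: cvgD; [exact: cf|exact: cg].
split=> [x|v]; first exact: differentiableD.
rewrite [X in Ck k X](_ : _ = fun x => 'D_v f x + 'D_v g x).
  exact: (IH _ _ (Df v) (Dg v)).
by apply/funext => x; apply: deriveD; exact: diff_derivable.
Qed.

Lemma CkM (f g : V -> R) (k : nat) :
  Ck k f -> Ck k g -> Ck k (fun x => f x * g x).
Proof.
elim: k f g => [f g cf cg x|k IH f g Cf Cg].
  by apply: cvgM; [exact: cf|exact: cg].
have [[df Df] [dg Dg]] := (Cf, Cg).
split=> [x|v]; first exact: differentiableM.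
rewrite [X in Ck k X](_ : _ = fun x => f x * 'D_v g x + g x * 'D_v f x).
  apply: CkD; first exact: (IH _ _ (Ck_le _ _ _ Cf) (Dg v)).
  exact: (IH _ _ (Ck_le _ _ _ Cg) (Df v)).
by apply/funext => x; apply: deriveM; exact: diff_derivable.
Qed.

(** A row-valued map is the finite sum of its coordinates times constant basis vectors, which gives
    continuity and differentiability. The induction continues because directional derivatives are
    taken coordinatewise. *)
Lemma Ck_row (n : nat) (f : V -> 'rV[R]_n) (k : nat) :
  (forall j, Ck k (fun x => f x 0 j)) -> Ck k f.
Proof.
have fE (g : V -> 'rV[R]_n) :
    g = \sum_(j < n) fun x => g x 0 j *: (delta_mx 0 j : 'rV[R]_n).
  by apply/funext => x; rewrite fct_sumE [LHS]row_sum_delta.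
elim: k f => [f cf x|k IH f Cf].
  rewrite (fE f); pose C (g : V -> 'rV[R]_n) := {for x, continuous g}.
  apply: (@big_ind _ C).
  - exact: cvg_cst.
  - by move=> g h cg ch; exact: continuousD.
  - by move=> j _; apply: cvgZr_tmp; exact: cf.
have df x : differentiable f x.
  rewrite (fE f); apply: differentiable_sum => j.
  by apply: differentiableZl; case: (Cf j).
split=> // v; apply: IH => j.
rewrite [X in Ck k X](_ : _ = fun x => 'D_v (fun y => f y 0 j) x).
  by case: (Cf j) => _; exact.
by apply/funext => x; rewrite derive_mx ?mxE //; exact: diff_derivable.
Qed.

Lemma smooth_cst (a : R) : smooth (fun _ : V => a).
Proof. by move=> k; exact: Ck_cst. Qed.

Lemma smoothD (f g : V -> R) :
  smooth f -> smooth g -> smooth (fun x => f x + g x).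
Proof. by move=> sf sg k; apply: CkD. Qed.

Lemma smoothM (f g : V -> R) :
  smooth f -> smooth g -> smooth (fun x => f x * g x).
Proof. by move=> sf sg k; apply: CkM. Qed.

Lemma smoothN (f : V -> R) : smooth f -> smooth (fun x => - f x).
Proof.
move=> sf; rewrite (_ : (fun x => _) = fun x => -1 * f x).
  by apply: smoothM => //; exact: smooth_cst.
by apply/funext => x; rewrite mulN1r.
Qed.

Lemma smoothX (f : V -> R) n : smooth f -> smooth (fun x => f x ^+ n).
Proof.
move=> sf; elim: n => [|n IH]; first exact: smooth_cst.
rewrite (_ : (fun x => _) = fun x => f x * f x ^+ n); first exact: smoothM.
by apply/funext => x; rewrite exprS.
Qed.

Lemma smooth_row n (f : V -> 'rV[R]_n) :
  (forall j, smooth (fun x => f x 0 j)) -> smooth f.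
Proof. by move=> sf k; apply: Ck_row => j; exact: sf. Qed.

End Generic.

(** A coordinate has constant directional derivatives, so a case distinction on the order replaces
    induction. *)
Lemma smooth_coord (m n : nat) i j :
  smooth (fun x : 'M[R]_(m, n) => x i j).
Proof.
case=> [|k] /=; first exact: coord_continuous.
split=> [x|v]; first exact: differentiable_coord.
rewrite [X in Ck k X](_ : _ = fun _ => v i j); first exact: Ck_cst.
by apply/funext => x; have ? := is_derive_coord R m n x v i j;
  rewrite derive_val.
Qed.

End Smooth.

Ltac smooth_poly :=
  repeat first [ apply: smooth_cst | apply: smooth_coord | apply: smoothD
               | apply: smoothN | apply: smoothM | apply: smoothX ].

(** * Lie derivatives of the contact forms and uniqueness of prolongations *)

Section Prolongation.
Context {R : realType}.
Implicit Types (m v : J2 R) (Y : J2 R -> J2 R).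

Lemma smooth_differentiable Y m : smooth Y -> differentiable Y m.
Proof. by move=> /(_ 1) [dY _]. Qed.

Lemma derive_coord Y m v j : differentiable Y m ->
  ('D_v Y m) 0 j = 'D_v (fun m' => Y m' 0 j) m.
Proof. by move=> dY; rewrite derive_mx ?mxE //; exact: diff_derivable. Qed.

(** The three contact forms share the shape dm_k - m_a dx - m_b dy, with (k, a, b) equal to (2, 3,
    4), (3, 5, 6) and (4, 6, 7). The a and b components of [Y] enter undifferentiated, so they can
    be solved for. *)
Lemma lie_contact_form Y (i : 'I_3) (k a b : 'I_8) m v :
    (forall m v, contact_form i m v = v 0 k - m 0 a * jx v - m 0 b * jy v) ->
    differentiable Y m ->
  lie_form Y (contact_form i) m v =
  'D_v (fun m' => Y m' 0 k) m - Y m 0 a * jx v - Y m 0 b * jy v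
  - m 0 a * 'D_v (fun m' => jx (Y m')) m - m 0 b * 'D_v (fun m' => jy (Y m')) m.
Proof.
move=> wE dY; rewrite /lie_form wE /jx /jy !derive_coord //.
have -> : (fun m' => contact_form i m' v) =
    fun m' => v 0 k - m' 0 a * jx v - m' 0 b * jy v by exact/funext.
have dw : is_derive m (Y m)
    (fun m' : J2 R => v 0 k - m' 0 a * jx v - m' 0 b * jy v)
    (- (Y m 0 a * jx v) - Y m 0 b * jy v).
  by apply: is_derive_eq; [is_derive_poly | rewrite /=; ring].
by rewrite (@derive_val _ _ _ _ _ _ _ dw) /jx /jy; ring.
Qed.

(* [a D_x + b D_y] with D_x, D_y the total derivatives, truncated at order 2. *)
Definition total (a b : R) m : J2 R :=
  \row_(j < 8) [:: a; b; jp m * a + jq m * b; jr m * a + js m * b;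
                   js m * a + jt m * b; 0; 0; 0]`_j.

Lemma contact_form_total a b m i : contact_form i m (total a b m) = 0.
Proof.
by case: i => -[|[|[|//]]] ?; rewrite /contact_form /jz /jx /jy /jp /jq !mxE /=;
   rewrite /jp /jq; ring.
Qed.

Lemma contact_coord_unique Y Y' (i : 'I_3) (k a b : 'I_8) :
    (forall m v, contact_form i m v = v 0 k - m 0 a * jx v - m 0 b * jy v) ->
    smooth Y -> smooth Y' -> preserves_contact Y -> preserves_contact Y' ->
    (forall m, jx (Y m) = jx (Y' m)) -> (forall m, jy (Y m) = jy (Y' m)) ->
    (forall m, Y m 0 k = Y' m 0 k) ->
  forall m, Y m 0 a = Y' m 0 a /\ Y m 0 b = Y' m 0 b.
Proof.
move=> wE sY sY' pY pY' ex ey ek m.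
have lie0 Z v : preserves_contact Z -> (forall j, contact_form j m v = 0) ->
    lie_form Z (contact_form i) m v = 0.
  by case=> lam [_ ->] v0; apply: big1 => j _; rewrite v0 mulr0.
(* On [total u w m] both Lie derivatives vanish. Their terms in the x, y and k components agree by
   [ex], [ey] and [ek]; cancelling them leaves this linear form in u and w. *)
have key u w : Y m 0 a * u + Y m 0 b * w = Y' m 0 a * u + Y' m 0 b * w.
  have v0 := contact_form_total u w m.
  have := lie0 _ _ pY v0; rewrite -(lie0 _ _ pY' v0).
  rewrite !(lie_contact_form _ i k a b) //; try exact: smooth_differentiable.
  rewrite (funext ex) (funext ey) (funext ek).
  have -> : jx (total u w m) = u by rewrite /jx mxE.
  have -> : jy (total u w m) = w by rewrite /jy mxE.
  move=> /addIr/addIr; rewrite -!addrA => /addrI.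
  by rewrite -!opprD => /oppr_inj.
by have := (key 1 0, key 0 1); rewrite !mulr1 !mulr0 !addr0 !add0r; case.
Qed.

Lemma prolongation_unique (X : J0 R -> J0 R) Y Y' :
  is_prolongation X Y -> is_prolongation X Y' -> Y = Y'.
Proof.
case=> sY XY pY [sY' XY' pY'].
have ej m : jproj (Y m) = jproj (Y' m) by rewrite XY XY'.
have ex m : jx (Y m) = jx (Y' m).
  by have /rowP/(_ (@Ordinal 3 0 isT)) := ej m; rewrite !mxE.
have ey m : jy (Y m) = jy (Y' m).
  by have /rowP/(_ (@Ordinal 3 1 isT)) := ej m; rewrite !mxE.
have ez m : jz (Y m) = jz (Y' m).
  by have /rowP/(_ (@Ordinal 3 2 isT)) := ej m; rewrite !mxE.
have step i k a b h := contact_coord_unique Y Y' i k a b h sY sY' pY pY' ex ey.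
(* Agreement climbs from z to (p, q), then from p to (r, s) and from q to (s, t). *)
have epq := step (@Ordinal 3 0 isT) (@Ordinal 8 2 isT) (@Ordinal 8 3 isT)
  (@Ordinal 8 4 isT) (fun _ _ => erefl) ez.
have ers := step (@Ordinal 3 1 isT) (@Ordinal 8 3 isT) (@Ordinal 8 5 isT)
  (@Ordinal 8 6 isT) (fun _ _ => erefl) (fun m => proj1 (epq m)).
have est := step (@Ordinal 3 2 isT) (@Ordinal 8 4 isT) (@Ordinal 8 6 isT)
  (@Ordinal 8 7 isT) (fun _ _ => erefl) (fun m => proj2 (epq m)).
apply/funext => m; apply/rowP.
have [ep eq] := epq m; have [er es] := ers m; have [_ et] := est m.
case=> -[|[|[|[|[|[|[|[|//]]]]]]]] lj.
(* The bound proofs are normalised to those in [jx], ..., [jt], so that the equalities found above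
   apply. *)
all: rewrite (bool_irrelevance lj isT).
all: first [ exact: ex | exact: ey | exact: ez | assumption ].
Qed.

End Prolongation.

(** * The general combination of the nine generators *)

Section SymmetryAlgebra.
Context {R : realType}.
Variable c : nat -> R.

(* [\sum_i c i *: X_i], with the generators X_1, ..., X_9 of the theorem. *)
Definition generator (n : J0 R) : J0 R :=
  let x := n 0 (@Ordinal 3 0 isT) in
  let y := n 0 (@Ordinal 3 1 isT) in
  let z := n 0 (@Ordinal 3 2 isT) in
  \row_(i < 3)
    [:: c 1 + c 6 * x + c 9 * x ^+ 2;
        c 2 + (c 6 + c 7) * y + c 8 * x + c 9 * (x * y);
        c 3 + c 4 * x + c 5 * y + (2 * c 6 + 3 * c 7) * z
        - c 8 * (2^-1 * y ^+ 2) + c 9 * (x * z - 6^-1 * y ^+ 3)]`_i.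

(* Its p, ..., t components are forced by the recursion along [total]. *)
Definition prolonged_generator (m : J2 R) : J2 R :=
  let x := m 0 (@Ordinal 8 0 isT) in
  let y := m 0 (@Ordinal 8 1 isT) in
  let z := m 0 (@Ordinal 8 2 isT) in
  let p := m 0 (@Ordinal 8 3 isT) in
  let q := m 0 (@Ordinal 8 4 isT) in
  let r := m 0 (@Ordinal 8 5 isT) in
  let s := m 0 (@Ordinal 8 6 isT) in
  let t := m 0 (@Ordinal 8 7 isT) in
  \row_(i < 8)
    [:: c 1 + c 6 * x + c 9 * x ^+ 2;
        c 2 + (c 6 + c 7) * y + c 8 * x + c 9 * (x * y);
        c 3 + c 4 * x + c 5 * y + (2 * c 6 + 3 * c 7) * z
        - c 8 * (2^-1 * y ^+ 2) + c 9 * (x * z - 6^-1 * y ^+ 3);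
        c 4 + (c 6 + 3 * c 7) * p - c 8 * q + c 9 * (z - x * p - y * q);
        c 5 + (c 6 + 2 * c 7) * q - c 8 * y - c 9 * (2^-1 * y ^+ 2);
        3 * c 7 * r - 2 * c 8 * s - c 9 * (3 * (x * r) + 2 * (y * s));
        2 * c 7 * s - c 8 * t - c 9 * (2 * (x * s) + y * t);
        c 7 * t - c 8 - c 9 * (y + x * t)]`_i.

Lemma smooth_generator : smooth generator.
Proof.
apply: smooth_row => -[j lj].
under [X in smooth X]funext do rewrite mxE.
by case: j lj => [|[|[|//]]] lj /=; smooth_poly.
Qed.

Lemma smooth_prolonged_generator : smooth prolonged_generator.
Proof.
apply: smooth_row => -[j lj].
under [X in smooth X]funext do rewrite mxE.
by case: j lj => [|[|[|[|[|[|[|[|//]]]]]]]] lj /=; smooth_poly.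
Qed.

Lemma jproj_prolonged_generator m :
  jproj (prolonged_generator m) = generator (jproj m).
Proof.
by apply/rowP => -[[|[|[|//]]] lj]; rewrite /jproj /jx /jy /jz !mxE.
Qed.

(** Each contact form contains exactly one of dz, dp, dq, with coefficient 1, and the x and y
    components of the field depend on x and y alone. Hence row i lists the coefficients of dz, dp,
    dq in the differential of the z, p or q component of [prolonged_generator]. *)
Definition contact_multiplier (i j : 'I_3) (m : J2 R) : R :=
  let x := m 0 (@Ordinal 8 0 isT) in
  let y := m 0 (@Ordinal 8 1 isT) in
  (nth [::]
  [:: [:: 2 * c 6 + 3 * c 7 + c 9 * x; 0; 0];
      [:: c 9; c 6 + 3 * c 7 - c 9 * x; - c 8 - c 9 * y];
      [:: 0; 0; c 6 + 2 * c 7]] i)`_j.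

(** The polynomial [f] is left to unification: [mxE] computes the row entry, and only then is it
    differentiated. *)
Lemma derive_prolonged_generator m v (j : 'I_8) (f : J2 R -> R) df :
    (forall m', prolonged_generator m' 0 j = f m') -> is_derive m v f df ->
  'D_v (fun m' => prolonged_generator m' 0 j) m = df.
Proof. by move=> /funext -> hf; exact: derive_val. Qed.

Lemma prolonged_generator_contact : preserves_contact prolonged_generator.
Proof.
exists contact_multiplier; split.
  by move=> [[|[|[|//]]] ?] [[|[|[|//]]] ?]; smooth_poly.
move=> i m v.
have dY := smooth_differentiable _ m smooth_prolonged_generator.
(* By [lie_contact_form], only the x, y, z, p and q components have to be differentiated; those in
   r, s, t occur undifferentiated. *)
have dx : 'D_v (fun m' => jx (prolonged_generator m')) m =
    c 6 * jx v + 2 * c 9 * jx m * jx v.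
  apply: derive_prolonged_generator => [m'|]; first by rewrite mxE.
  by apply: is_derive_eq; [is_derive_poly | rewrite /jx /=; ring].
have dy : 'D_v (fun m' => jy (prolonged_generator m')) m =
    (c 6 + c 7) * jy v + c 8 * jx v + c 9 * (jx m * jy v + jy m * jx v).
  apply: derive_prolonged_generator => [m'|]; first by rewrite mxE.
  by apply: is_derive_eq; [is_derive_poly | rewrite /jx /jy /=; ring].
have dz : 'D_v (fun m' => prolonged_generator m' 0 (@Ordinal 8 2 isT)) m =
    c 4 * jx v + c 5 * jy v + (2 * c 6 + 3 * c 7) * jz v - c 8 * (jy m * jy v)
    + c 9 * (jx m * jz v + jz m * jx v - 2^-1 * jy m ^+ 2 * jy v).
  apply: derive_prolonged_generator => [m'|]; first by rewrite mxE.
  by apply: is_derive_eq; [is_derive_poly | rewrite /jx /jy /jz /=; field].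
have dp : 'D_v (fun m' => prolonged_generator m' 0 (@Ordinal 8 3 isT)) m =
    (c 6 + 3 * c 7) * jp v - c 8 * jq v
    + c 9 * (jz v - jx m * jp v - jp m * jx v - jy m * jq v - jq m * jy v).
  apply: derive_prolonged_generator => [m'|]; first by rewrite mxE.
  apply: is_derive_eq; first by is_derive_poly.
  by rewrite /jx /jy /jz /jp /jq /=; ring.
have dq : 'D_v (fun m' => prolonged_generator m' 0 (@Ordinal 8 4 isT)) m =
    (c 6 + 2 * c 7) * jq v - c 8 * jy v - c 9 * (jy m * jy v).
  apply: derive_prolonged_generator => [m'|]; first by rewrite mxE.
  by apply: is_derive_eq; [is_derive_poly | rewrite /jy /jq /=; field].
rewrite !big_ord_recl big_ord0.
have coordE := (dx, dy, dz, dp, dq).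
case: i => -[|[|[|//]]] li.
- rewrite (lie_contact_form _ _ (@Ordinal 8 2 isT) (@Ordinal 8 3 isT)
    (@Ordinal 8 4 isT)) // !coordE /contact_form /contact_multiplier !mxE /=.
  by rewrite /jx /jy /jz /jp /jq /jr /js /jt; field.
- rewrite (lie_contact_form _ _ (@Ordinal 8 3 isT) (@Ordinal 8 5 isT)
    (@Ordinal 8 6 isT)) // !coordE /contact_form /contact_multiplier !mxE /=.
  by rewrite /jx /jy /jz /jp /jq /jr /js /jt; field.
- rewrite (lie_contact_form _ _ (@Ordinal 8 4 isT) (@Ordinal 8 6 isT)
    (@Ordinal 8 7 isT)) // !coordE /contact_form /contact_multiplier !mxE /=.
  by rewrite /jx /jy /jz /jp /jq /jr /js /jt; field.
Qed.

Lemma generator_prolongation : is_prolongation generator prolonged_generator.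
Proof.
split; [exact: smooth_prolonged_generator | exact: jproj_prolonged_generator |].
exact: prolonged_generator_contact.
Qed.

(** The two bases are rescaled by factors in ratio 2 to 3, so the cube of the first and the square
    of the second acquire the same factor, whatever the constants k and l. *)
Lemma generator_symmetry (k l : R) :
  is_symmetry (fun m : J2 R =>
    k * (2 * js m - jt m ^+ 2) ^+ 3
    + l * (3 * jr m - 6 * js m * jt m + 2 * jt m ^+ 3) ^+ 2) generator.
Proof.
split; first exact: smooth_generator.
exists prolonged_generator; split; first exact: generator_prolongation.
  by move=> Y' pY'; apply: prolongation_unique pY' generator_prolongation.
move=> m Fm0; set F := (F in lie_fun _ F).
have dF : is_derive m (prolonged_generator m) F
    ((6 * c 7 - 6 * c 9 * jx m) * F m).
  apply: is_derive_eq; first by rewrite /F; is_derive_poly.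
  by rewrite /F /prolonged_generator !mxE /= /jx /jr /js /jt; ring.
by rewrite /lie_fun (@derive_val _ _ _ _ _ _ _ dF) [F m]Fm0 mulr0.
Qed.

End SymmetryAlgebra.

Theorem corollary7p1 (R : realType) (eps a : R)
  (heps : eps = 1 \/ eps = -1) (ha : 0 < a <= 1) (hne : (eps, a) <> (1, 1)) :
  let F := fun m : J2 R =>
    (eps + a) ^+ 2 * (2 * js m - jt m ^+ 2) ^+ 3
    + eps * a * (3 * jr m - 6 * js m * jt m + 2 * jt m ^+ 3) ^+ 2 in
  is_symmetry F (fun _ => Dx) /\
  is_symmetry F (fun _ => Dy) /\
  is_symmetry F (fun _ => Dz) /\
  is_symmetry F (fun n => x0 n *: Dz) /\
  is_symmetry F (fun n => y0 n *: Dz) /\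
  is_symmetry F (fun n => x0 n *: Dx + y0 n *: Dy + (2 * z0 n) *: Dz) /\
  is_symmetry F (fun n => y0 n *: Dy + (3 * z0 n) *: Dz) /\
  is_symmetry F (fun n => x0 n *: Dy - (2^-1 * y0 n ^+ 2) *: Dz) /\
  is_symmetry F (fun n => x0 n ^+ 2 *: Dx + (x0 n * y0 n) *: Dy
                          + (x0 n * z0 n - 6^-1 * y0 n ^+ 3) *: Dz).
Proof.
move=> F.
(* The field X_i is the combination with Kronecker delta coefficients; k and l become
   [(eps + a) ^+ 2] and [eps * a]. *)
have main i X : X = generator (fun j => (i == j)%:R) -> is_symmetry F X.
  by move=> ->; exact: generator_symmetry.
refine (conj (main 1 _ _) (conj (main 2 _ _) (conj (main 3 _ _)
  (conj (main 4 _ _) (conj (main 5 _ _) (conj (main 6 _ _)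
  (conj (main 7 _ _) (conj (main 8 _ _) (main 9 _ _))))))))).
all: apply/funext => n; apply/rowP => -[[|[|[|//]]] lj].
all: rewrite /x0 /y0 /z0 !mxE /=; ring.
Qed.
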